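(* Let $p$ be an odd prime. Then $$\sum_{k=1}^{(p-1)/2}\frac{\binom{2k}{k}}{2^k}H_k^2\equiv(-1)^{(p-1)/2}q_p(2)^2-E_{p-3}\pmod p.$$
   Context: $H_k=\sum_{0<j\le k}\frac1j$ is the $k$-th harmonic number. $q_p(2)=(2^{p-1}-1)/p$ is the Fermat quotient. The Euler numbers $E_n$ are defined by $\frac{2e^t}{e^{2t}+1}=\sum_{n\ge 0}E_n\frac{t^n}{n!}$. Congruences between rational numbers with denominators coprime to $p$ are understood in the ring of rationals with denominator prime to $p$. *)

(* Defs.v *)
From HB Require Import structures.
From mathcomp Require Import all_boot all_order all_algebra.

Set Implicit Arguments.
Unset Strict Implicit.
Unset Printing Implicit Defensive.

Import Order.TTheory GRing.Theory Num.Theory.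
Local Open Scope ring_scope.

Definition harmonic (k : nat) : rat := \sum_(1 <= j < k.+1) (j%:R)^-1.

Definition fermat_quotient (p a : nat) : rat := (a%:R ^+ (p - 1) - 1) / p%:R.

(* Formal power series over rat, as sequences of coefficients. *)
Definition fps := nat -> rat.

Definition fps_mul (f g : fps) : fps :=
  fun n => \sum_(i < n.+1) f i * g (n - i)%N.

(* The series of exp (a t). *)
Definition fps_exp (a : rat) : fps := fun n => a ^+ n / n`!%:R.

Definition fps_const (c : rat) : fps := fun n => if n is 0%N then c else 0.

Definition fps_add (f g : fps) : fps := fun n => f n + g n.

Definition fps_scale (c : rat) (f : fps) : fps := fun n => c * f n.

(* The first n coefficients of the quotient f / g, where g 0 <> 0, by long
   division; lemma fps_divP below is the specification. *)
Fixpoint fps_div_coefs (f g : fps) (n : nat) : seq rat :=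
  if n is m.+1 then
    let s := fps_div_coefs f g m in
    rcons s ((f m - \sum_(i < m) s`_i * g (m - i)%N) / g 0%N)
  else [::].

Definition fps_div (f g : fps) : fps :=
  fun n => (fps_div_coefs f g n.+1)`_n.

Lemma size_fps_div_coefs (f g : fps) (n : nat) :
  size (fps_div_coefs f g n) = n.
Proof. by elim: n => //= n IHn; rewrite size_rcons IHn. Qed.

Lemma nth_fps_div_coefs (f g : fps) (n i : nat) :
  (i < n)%N -> (fps_div_coefs f g n)`_i = fps_div f g i.
Proof.
elim: n => // n IHn; rewrite ltnS leq_eqVlt => /orP[/eqP-> //|lt_in].
by rewrite /= nth_rcons size_fps_div_coefs lt_in IHn.
Qed.

Lemma fps_divP (f g : fps) :
  g 0%N != 0 -> fps_mul (fps_div f g) g =1 f.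
Proof.
move=> g0 n; rewrite /fps_mul big_ord_recr /= subnn.
rewrite {2}/fps_div /= nth_rcons size_fps_div_coefs ltnn eqxx divfK //.
rewrite (eq_bigr (fun i : 'I_n => (fps_div_coefs f g n)`_i * g (n - i)%N)).
  by rewrite addrC subrK.
by move=> i _; rewrite nth_fps_div_coefs.
Qed.

(* E_n is n! times the coefficient of t^n in 2 e^t / (e^(2t) + 1). *)
Definition euler_number (n : nat) : rat :=
  n`!%:R * fps_div (fps_scale 2 (fps_exp 1))
                   (fps_add (fps_exp 2) (fps_const 1)) n.

Lemma euler_number_gen :
  fps_mul (fun n => euler_number n / n`!%:R)
          (fps_add (fps_exp 2) (fps_const 1))
  =1 fps_scale 2 (fps_exp 1).
Proof.
move=> n; rewrite -[RHS](@fps_divP _ (fps_add (fps_exp 2) (fps_const 1))) //.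
apply: eq_bigr => i _; congr (_ * _).
by rewrite /euler_number mulrC mulKf // pnatr_eq0 -lt0n fact_gt0.
Qed.

(* The ring Z_(p) of rationals with denominator prime to p. *)
Definition p_integral (p : nat) (x : rat) : bool := coprime p `|denq x|%N.

(* Congruence modulo the ideal p Z_(p) of Z_(p); both sides are required to
   lie in Z_(p). *)
Definition rat_congr (p : nat) (x y : rat) : Prop :=
  [/\ p_integral p x, p_integral p y &
      exists2 z : rat, p_integral p z & x - y = p%:R * z].

(* Main.v *)
Require Import Defs.
From HB Require Import structures.
From mathcomp Require Import all_boot all_order all_algebra.
From mathcomp Require Import ring zify.

Set Implicit Arguments.
Unset Strict Implicit.
Unset Printing Implicit Defensive.

Import Order.TTheory GRing.Theory Num.Theory.
Local Open Scope ring_scope.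

(** Put [p = 2n + 1].  Modulo [p] one has ['C(2k, k) / 2^k = 'C(n, k) (-2)^k],
    so the left side becomes a binomial transform of [H_k^2] at [-2].  Since
    [1 + (-2) = -1], this transform has a closed form
    [(-1)^n sum_(i <= n) (2 + (-1)^i) (H_i - A_i) / i] with
    [A_i = sum_(l <= i) (-1)^l / l], valid in every field where [n!] is
    invertible.  Expanding it leaves [H_n], [A_n], [sum_(l <= n) (-1)^l / l^2]
    and the double sum [W_n = sum_(i <= n) A_i / i].
    Modulo [p], [H_n = -2q] and [A_n = -q] for [q = q_p(2)].  The reflection
    [k -> p - k] expresses [W_n] through [W_(p-1)], and [W_(p-1) = - q^2] comes
    from evaluating [sum_j (-1)^j / j * A_(p-1-j)] in two ways: by reflection,
    and by partial fractions [1/(jk) = (1/j + 1/k)/(j + k)].  Finally [E_m] and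
    [sum_(i < p) (-1)^i (2i + 1)^m] satisfy the same recurrence modulo [p],
    which turns [sum_(l <= n) (-1)^l / l^2] into [2 (-1)^n E_(p-3)]. *)

(** * Binomial transforms of harmonic numbers in a field *)

Definition psum (F : fieldType) (f : nat -> F) (n : nat) : F :=
  \sum_(i < n) f i.+1.

Definition inv_nat (F : fieldType) (k : nat) : F := k%:R^-1.
Definition alt_inv (F : fieldType) (k : nat) : F := (-1) ^+ k / k%:R.

Definition harm (F : fieldType) : nat -> F := psum (@inv_nat F).
Definition alt_harm (F : fieldType) : nat -> F := psum (@alt_inv F).
Definition harm2 (F : fieldType) : nat -> F := psum (fun k => k%:R^-1 ^+ 2).
Definition alt_harm2 (F : fieldType) : nat -> F :=
  psum (fun k => (-1) ^+ k * k%:R^-1 ^+ 2).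
Definition alt_harm_double (F : fieldType) : nat -> F :=
  psum (fun k => alt_harm F k / k%:R).

(** Only the denominators that occur are constrained, so the identities below cover characteristic 0
    and ['F_p] with [n < p] alike. *)
Definition nz_upto (F : fieldType) (n : nat) : Prop :=
  forall k, (k < n)%N -> k.+1%:R != 0 :> F.

Definition btrans (F : fieldType) (n : nat) (f : nat -> F) : F :=
  \sum_(k < n.+1) 'C(n, k)%:R * (-2) ^+ k * f k.

Lemma psumS (F : fieldType) (f : nat -> F) n :
  psum f n.+1 = psum f n + f n.+1.
Proof. exact: big_ord_recr. Qed.

Lemma psum0 (F : fieldType) (f : nat -> F) : psum f 0 = 0.
Proof. exact: big_ord0. Qed.

Lemma psum_rev (F : fieldType) (f : nat -> F) n :
  psum f n = \sum_(i < n) f (n - i)%N.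
Proof.
rewrite /psum (reindex_inj rev_ord_inj) /=; apply: eq_bigr => i _.
by rewrite subnSK.
Qed.

Lemma psum_cat (F : fieldType) (f : nat -> F) m n :
  psum f (m + n) = psum f m + psum (fun k => f (m + k)%N) n.
Proof.
rewrite /psum big_split_ord; congr (_ + _).
by apply: eq_bigr => i _ /=; rewrite addnS.
Qed.

Lemma sign_mul_self (F : fieldType) k : (-1) ^+ k * (-1) ^+ k = 1 :> F.
Proof. by rewrite -expr2 sqrr_sign. Qed.

Lemma nz_uptoW (F : fieldType) n : nz_upto F n.+1 -> nz_upto F n.
Proof. by move=> h k /ltnW; exact: h. Qed.

(** Pascal's rule; the shifted exponent in its second part yields the factor [-2]. *)
Lemma btransS (F : fieldType) n (f : nat -> F) :
  btrans n.+1 f = btrans n f - 2 * btrans n (fun k => f k.+1).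
Proof.
rewrite /btrans big_ord_recl bin0 (eq_bigr (fun k : 'I_n.+1 =>
  'C(n, k.+1)%:R * (-2) ^+ k.+1 * f k.+1
  + (-2) * ('C(n, k)%:R * (-2) ^+ k * f k.+1))); last first.
  by move=> k _; rewrite /= /bump add1n binS natrD exprS; ring.
rewrite big_split addrA -mulr_sumr mulNr /=; congr (_ + _).
have -> : 1%:R * (-2) ^+ 0 * f 0%N = 'C(n, 0)%:R * (-2) ^+ 0 * f 0%N.
  by rewrite bin0.
rewrite -(big_ord_recl n.+1 (fun k : 'I_n.+2 => 'C(n, k)%:R * (-2) ^+ k * f k)).
by rewrite big_ord_recr /= bin_small // !mul0r addr0.
Qed.

(** Absorption: [C(n, k) / (k + 1) = C(n + 1, k + 1) / (n + 1)]. The index 0 of the larger transform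
    is not reached, hence the subtracted [g 0]. *)
Lemma btrans_shift (F : fieldType) n (g : nat -> F) : nz_upto F n.+1 ->
  -2 * btrans n (fun k => g k.+1 / k.+1%:R)
    = (btrans n.+1 g - g 0%N) / n.+1%:R.
Proof.
move=> nz; rewrite /btrans [in RHS]big_ord_recl bin0 mul1r mul1r addrC addKr.
rewrite mulr_sumr mulr_suml; apply: eq_bigr => k _; rewrite /= /bump add1n exprS.
have k0 := nz _ (ltn_ord k); have n0 := nz _ (ltnSn n).
have /(congr1 (fun m => m%:R : F)) := mul_bin_diag n.+1 k.
rewrite !natrM /= => e.
have -> : 'C(n, k)%:R = k.+1%:R * 'C(n.+1, k.+1)%:R / n.+1%:R :> F.
  by rewrite -e mulrC mulKf.
by move: (k.+1%:R : F) (n.+1%:R : F) k0 n0 => u v u0 v0; field; rewrite u0 v0.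
Qed.

Lemma btrans_ext (F : fieldType) n (f g : nat -> F) :
  f =1 g -> btrans n f = btrans n g.
Proof. by move=> fg; apply: eq_bigr => k _; rewrite fg. Qed.

Lemma btransD (F : fieldType) n c (f g : nat -> F) :
  btrans n (fun k => c * f k + g k) = c * btrans n f + btrans n g.
Proof.
by rewrite /btrans mulr_sumr -big_split; apply: eq_bigr => k _ /=; ring.
Qed.

Lemma btrans1 (F : fieldType) n : btrans n (fun=> 1 : F) = (-1) ^+ n.
Proof.
have -> : (-1 : F) = 1 + -2 by ring.
rewrite exprDn; apply: eq_bigr => k _.
by rewrite expr1n mul1r mulr1 mulr_natl.
Qed.

(** In [btransS] the shifted [f] contains [f] itself, and [1 - 2 = -1] flips the sign; the
    increments are absorbed by [btrans_shift]. *)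
Lemma btrans_step (F : fieldType) n (f g : nat -> F) : nz_upto F n.+1 ->
  (forall k, f k.+1 = f k + g k.+1 / k.+1%:R) ->
  btrans n.+1 f = - btrans n f + (btrans n.+1 g - g 0%N) / n.+1%:R.
Proof.
move=> nz fg; rewrite btransS -btrans_shift // (btrans_ext _
  (f := fun k => f k.+1) (g := fun k => 1 * f k + g k.+1 / k.+1%:R)).
  by rewrite btransD; ring.
by move=> k; rewrite fg mul1r.
Qed.

(** The convention [0^-1 = 0] removes the term [k = 0]. By [btrans_shift] at the constant 1, passing
    from [n] to [n + 1] adds [((-1)^(n + 1) - 1) / (n + 1)]. *)
Lemma btrans_inv_nat (F : fieldType) n : nz_upto F n ->
  btrans n (@inv_nat F) = alt_harm F n - harm F n.
Proof.
elim: n => [|n IHn] nz.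
  rewrite /btrans big_ord_recl big_ord0 /alt_harm /harm !psum0 /inv_nat invr0.
  by ring.
rewrite btransS IHn; last exact: nz_uptoW.
have := btrans_shift (fun=> 1) nz.
rewrite btrans1 /alt_harm /harm !psumS -mulNr /inv_nat /alt_inv.
rewrite (btrans_ext _ (g := fun k => k.+1%:R^-1)); last by move=> k; rewrite mul1r.
by move=> ->; ring.
Qed.

Lemma btrans_harm (F : fieldType) n : nz_upto F n ->
  btrans n (harm F) = (-1) ^+ n * (harm F n - alt_harm F n).
Proof.
elim: n => [|n IHn] nz.
  by rewrite /btrans big_ord_recl big_ord0 /alt_harm /harm !psum0; ring.
have nz1 : n.+1%:R != 0 :> F by exact: nz.
rewrite (btrans_step (g := fun=> 1) nz); last first.
  by move=> k; rewrite /harm psumS mul1r.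
rewrite btrans1 IHn; last exact: nz_uptoW.
rewrite /alt_harm /harm !psumS /alt_inv /inv_nat exprS mulN1r.
have := sign_mul_self F n; move: ((-1) ^+ n) (n.+1%:R : F) nz1 => s v v0 ss.
by field: ss.
Qed.

Lemma btrans_harm_sqr (F : fieldType) n : nz_upto F n ->
  btrans n (fun k => harm F k ^+ 2)
  = (-1) ^+ n * psum (fun i => (2 + (-1) ^+ i) *
                               (harm F i - alt_harm F i) / i%:R) n.
Proof.
elim: n => [|n IHn] nz.
  by rewrite /btrans big_ord_recl big_ord0 /harm !psum0; ring.
have nz1 : n.+1%:R != 0 :> F by exact: nz.
(* From [H_(k+1)^2 - H_k^2 = (2 H_(k+1) - 1 / (k+1)) / (k+1)]. *)
rewrite (btrans_step (g := fun k => 2 * harm F k + -1 * inv_nat F k) nz).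
  (* Adding a zero function makes [btransD] serve as the rule for scalar multiples. *)
  rewrite btransD (btrans_ext _ (f := fun k => -1 * _ k)
    (g := fun k => -1 * inv_nat F k + 0)); last by move=> k; ring.
  rewrite btransD btrans_harm // btrans_inv_nat // IHn; last exact: nz_uptoW.
  rewrite psumS /inv_nat invr0 (_ : harm F 0 = 0); last exact: psum0.
  rewrite (_ : btrans _ _ = 0); last by apply: big1 => k _; rewrite mulr0.
  rewrite exprS mulN1r.
  have := sign_mul_self F n.
  move: ((-1) ^+ n) (n.+1%:R : F) nz1 => s v v0 ss.
  by field: ss.
move=> k; rewrite /harm psumS /inv_nat; ring.
Qed.

(** * Quadratic and double harmonic sums over a field *)

(** Multiplied out, the sums of [H_i / i] and [(-1)^i A_i / i] are half of a square plus its
    diagonal, while the two mixed sums add up to a product plus its diagonal; this leaves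
    [-4 - 2 = -6] copies of the double sum. *)
Lemma double_sum_expand (F : fieldType) n :
  2 * psum (fun i => (2 + (-1) ^+ i) * (harm F i - alt_harm F i) / i%:R) n
  = 2 * harm F n ^+ 2 + harm2 F n - alt_harm F n ^+ 2
    + 2 * harm F n * alt_harm F n + 2 * alt_harm2 F n
    - 6 * alt_harm_double F n.
Proof.
elim: n => [|n IHn].
  by rewrite /harm /alt_harm /harm2 /alt_harm2 /alt_harm_double !psum0; ring.
rewrite psumS mulrDr IHn /alt_harm_double /harm2 /alt_harm2 !psumS.
rewrite /harm /alt_harm !psumS /inv_nat /alt_inv.
have := sign_mul_self F n.+1; set s := (-1) ^+ n.+1 => ss.
ring: ss.
Qed.

(** The product is a sum over a square of index pairs, cut along the diagonal; [m.-1] keeps the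
    diagonal from being counted twice. *)
Lemma alt_harm_double_swap (F : fieldType) n :
  alt_harm_double F n + psum (fun m => alt_inv F m * harm F m.-1) n
  = alt_harm F n * harm F n.
Proof.
elim: n => [|n IHn]; first by rewrite /alt_harm_double /alt_harm !psum0; ring.
rewrite /alt_harm_double !psumS addrACA IHn.
by rewrite /harm /alt_harm !psumS /inv_nat /alt_inv /=; ring.
Qed.

(** Off-diagonal pairs occur twice in the square; on the diagonal the signs cancel and leave
    [harm2]. *)
Lemma alt_harm_sqr (F : fieldType) n :
  alt_harm F n ^+ 2 + harm2 F n
  = 2 * psum (fun j => alt_inv F j * alt_harm F j) n.
Proof.
elim: n => [|n IHn]; first by rewrite /harm2 /alt_harm !psum0; ring.
rewrite psumS mulrDr -IHn /harm2 /alt_harm !psumS /alt_inv.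
have := sign_mul_self F n.+1; set s := (-1) ^+ n.+1 => ss.
ring: ss.
Qed.

(** Changing all signs to minus alters only the even terms, by [2 / (2j) = 1 / j]. *)
Lemma alt_harm_even (F : fieldType) n : nz_upto F n.*2 ->
  alt_harm F n.*2 = harm F n - harm F n.*2.
Proof.
elim: n => [|n IHn].
  by rewrite double0 => _; rewrite /alt_harm /harm !psum0; ring.
rewrite doubleS => nz; rewrite /harm /alt_harm !psumS.
rewrite -/(harm F _) -/(alt_harm F _).
rewrite IHn; last by do 2 apply: nz_uptoW.
rewrite /inv_nat /alt_inv !exprS -muln2 exprM sqrr_sign.
have nz1 : n.+1%:R != 0 :> F by apply: nz; lia.
have nz2 : (n * 2).+2%:R != 0 :> F by apply: nz; lia.
have e : (n * 2).+2%:R = 2 * n.+1%:R :> F by rewrite -natrM; congr _%:R; lia.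
have nz3 : 2 != 0 :> F by apply: contraNneq nz2 => z; rewrite e z mul0r.
rewrite e -[psum _ _]/(harm F (n * 2)).
move: (n.+1%:R : F) ((n * 2).+1%:R : F) (harm F (n * 2)) nz1 nz3 => v t y v0 z0.
move: (t^-1) => {}t; field; rewrite ?v0 ?z0 //.
Qed.

Lemma eq_psum (F : fieldType) (f g : nat -> F) n :
  (forall k, (0 < k <= n)%N -> f k = g k) -> psum f n = psum g n.
Proof. by move=> fg; apply: eq_bigr => i _; apply: fg; rewrite /= ltn_ord. Qed.

Lemma psumZ (F : fieldType) c (f : nat -> F) n :
  psum (fun k => c * f k) n = c * psum f n.
Proof. by rewrite /psum mulr_sumr. Qed.

Lemma psumD (F : fieldType) (f g : nat -> F) n :
  psum (fun k => f k + g k) n = psum f n + psum g n.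
Proof. exact: big_split. Qed.

(** Folds back the last [k] terms; for [N = p - 1] the reflection is negation modulo [p]. *)
Lemma psum_reflect (F : fieldType) c (f : nat -> F) N k : (k <= N)%N ->
  (forall j, (0 < j <= k)%N -> f (N.+1 - j)%N = c * f j) ->
  psum f N = psum f (N - k)%N + c * psum f k.
Proof.
move=> kN fc; rewrite -{1}(subnK kN) psum_cat -psumZ; congr (_ + _).
rewrite psum_rev; apply: eq_bigr => i _; rewrite -fc; last by rewrite /= ltn_ord.
by congr f; have := ltn_ord i; lia.
Qed.

(** From [N] to [N + 1] each term gains [(-1)^(N+1) / (j (N+1-j))]. Partial fractions turn this into
    [(-1)^(N+1) / (N+1)] times [1/j + 1/(N+1-j)], and both halves sum to [H_N]. *)
Lemma alt_convolution (F : fieldType) N : nz_upto F N ->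
  psum (fun j => alt_inv F j * alt_harm F (N - j)%N) N
  = 2 * psum (fun m => alt_inv F m * harm F m.-1) N.
Proof.
elim: N => [|N IHN] nz; first by rewrite !psum0 mulr0.
rewrite !psumS subnn mulrDr -IHN; last exact: nz_uptoW.
have -> : alt_harm F 0 = 0 by exact: psum0.
rewrite mulr0 addr0 /=.
rewrite (eq_psum (g := fun j => alt_inv F j * alt_harm F (N - j)%N
    + alt_inv F N.+1 * (inv_nat F j + inv_nat F (N.+1 - j)%N))).
  rewrite psumD psumZ psumD; congr (_ + _).
  have -> : psum (fun j => inv_nat F (N.+1 - j)%N) N = harm F N.
    by rewrite /harm [RHS]psum_rev.
  by rewrite /harm; ring.
move=> k /andP[k0 kN]; rewrite subSn // /alt_harm psumS mulrDr; congr (_ + _).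
have nk : k%:R != 0 :> F by rewrite -(prednK k0); apply: nz; lia.
have nd : (N - k).+1%:R != 0 :> F by apply: nz; lia.
have nN : N.+1%:R != 0 :> F by apply: nz.
have e : N.+1%:R = k%:R + (N - k).+1%:R :> F by rewrite -natrD; congr _%:R; lia.
have es : (-1) ^+ N.+1 = (-1) ^+ k * (-1) ^+ (N - k).+1 :> F.
  by rewrite -exprD; congr (_ ^+ _); lia.
rewrite /alt_inv /inv_nat es e; rewrite e in nN.
move: (k%:R : F) ((N - k).+1%:R : F) nk nd nN => x y x0 y0 xy0.
by field; rewrite x0 y0 xy0.
Qed.

(** * Harmonic sums modulo p *)

Lemma Fp_natr_eq0 p m : prime p -> (m%:R == 0 :> 'F_p) = (p %| m)%N.
Proof. by move=> pr; rewrite -(dvdn_pcharf (pchar_Fp pr)). Qed.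

Lemma Fp_nz_upto p : prime p -> nz_upto 'F_p p.-1.
Proof.
move=> pr k kp; rewrite Fp_natr_eq0 //; apply/negP => /dvdn_leq; lia.
Qed.

Lemma Fp_two_neq0 n : prime n.*2.+1 -> 2 != 0 :> 'F_n.*2.+1.
Proof.
move=> pr; rewrite Fp_natr_eq0 //; apply/negP => /dvdn_leq.
by case: n pr => [|[|n]] //; lia.
Qed.

Lemma Fp_natr_refl p j : prime p -> (j <= p)%N -> (p - j)%:R = - j%:R :> 'F_p.
Proof.
move=> pr jp; rewrite natrB // (_ : p%:R = 0) ?sub0r //.
by apply/eqP; rewrite Fp_natr_eq0.
Qed.

(** Since [C(p, k + 1)] vanishes modulo [p], Pascal's rule makes consecutive values opposite. *)
Lemma Fp_bin_pred p k : prime p -> (k < p)%N ->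
  'C(p.-1, k)%:R = (-1) ^+ k :> 'F_p.
Proof.
move=> pr; elim: k => [|k IHk] kp; first by rewrite bin0.
have: 'C(p, k.+1)%:R == 0 :> 'F_p by rewrite Fp_natr_eq0 // prime_dvd_bin.
have -> : 'C(p, k.+1) = ('C(p.-1, k.+1) + 'C(p.-1, k))%N.
  by rewrite -binS prednK // prime_gt0.
rewrite natrD IHk ?(ltnW kp) // addr_eq0.
by move=> /eqP ->; rewrite exprS mulN1r.
Qed.

Lemma dvdn_fermat2 p : prime p -> odd p -> (p %| 2 ^ p.-1 - 1)%N.
Proof.
move=> pr po; have p0 := prime_gt0 pr.
have cp : coprime p 2 by rewrite coprimen2.
have /eqP := fermat_little 2 pr.
rewrite -(Gauss_dvdr _ cp) mulnBr -expnS prednK // eqn_mod_dvd //.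
by rewrite -{1}(expn1 2) leq_exp2l.
Qed.

(** Divide [2^p - 2], the sum of the inner binomials [C(p, k)], by [p]: here
    [C(p, k) / p = C(p-1, k-1) / k], which is [(-1)^(k-1) / k] modulo [p]. *)
Lemma fermat_quotient_alt_harm p : prime p -> odd p ->
  2 * ((2 ^ p.-1 - 1) %/ p)%:R = - alt_harm 'F_p p.-1.
Proof.
move=> pr po; have p0 := prime_gt0 pr.
have dq := dvdn_fermat2 pr po.
have E : \sum_(k < p.-1) ('C(p, k.+1) %/ p)%N = (2 * ((2 ^ p.-1 - 1) %/ p))%N.
  apply/eqP; rewrite -(eqn_pmul2r p0) -mulnA divnK // big_distrl /=; apply/eqP.
  rewrite (eq_bigr (fun k : 'I_p.-1 => 'C(p, k.+1))); last first.
    by move=> k _; rewrite divnK // prime_dvd_bin //=; have := ltn_ord k; lia.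
  have ends (m : nat) (f : nat -> nat) : (0 < m)%N ->
      (\sum_(i < m.+1) f i = f 0 + \sum_(i < m.-1) f i.+1 + f m)%N.
    by case: m => // m _; rewrite big_ord_recr big_ord_recl.
  rewrite mulnBr -expnS prednK //; have := Pascal 1 1 p.
  rewrite (eq_bigr (fun i : 'I_p.+1 => 'C(p, i))); last first.
    by move=> i _; rewrite !exp1n !muln1.
  rewrite (ends _ (fun i => 'C(p, i))) // bin0 binn addn1 => ->.
  by rewrite addnAC; exact: esym (addKn 2 _).
rewrite -natrM -E natr_sum /alt_harm /psum -sumrN; apply: eq_bigr => k _.
have k0 : k.+1%:R != 0 :> 'F_p by exact: (Fp_nz_upto pr).
have : (k.+1 * ('C(p, k.+1) %/ p) = 'C(p.-1, k))%N.
  apply/eqP; rewrite -(eqn_pmul2r p0) -mulnA divnK; last first.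
    by rewrite prime_dvd_bin //=; have := ltn_ord k; lia.
  by rewrite -mul_bin_diag mulnC.
move/(congr1 (fun m => m%:R : 'F_p)); rewrite natrM Fp_bin_pred; last first.
- by have := ltn_ord k; lia.
- by [].
move=> e; rewrite /alt_inv exprS mulN1r -e mulNr opprK mulrC mulKf //.
Qed.

Lemma psum_double (F : fieldType) (f : nat -> F) n :
  psum f n.*2 = psum f n + psum (fun k => f (n + k)%N) n.
Proof. by rewrite -addnn psum_cat. Qed.

Lemma Fp_harm_full n : prime n.*2.+1 -> harm 'F_n.*2.+1 n.*2 = 0.
Proof.
move=> pr.
have refl j : (0 < j <= n.*2)%N ->
    inv_nat 'F_n.*2.+1 (n.*2.+1 - j) = -1 * inv_nat _ j.
  by move=> /andP[_ jn]; rewrite /inv_nat Fp_natr_refl ?invrN ?mulN1r // leqW.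
have := psum_reflect (leqnn n.*2) refl.
rewrite subnn psum0 add0r mulN1r => /eqP.
rewrite -subr_eq0 opprK -mulr2n -mulr_natl mulf_eq0.
by rewrite (negPf (Fp_two_neq0 pr)) => /eqP.
Qed.

Lemma Fp_sum_natr p (f : 'F_p -> 'F_p) : prime p ->
  \sum_(i < p) f i%:R = \sum_(x : 'F_p) f x.
Proof.
move=> pr.
(* The ordinal bound built into ['F_p] equals [p] only propositionally; a variable [m] avoids
   rewriting inside the type. *)
have sumE m (g : nat -> 'F_p) : m = p -> \sum_(i < p) g i = \sum_(i < m) g i.
  by move=> ->.
rewrite (sumE _ (fun i => f i%:R) (Fp_cast pr)); apply: eq_bigr => i _.
by rewrite natr_Zp.
Qed.

(** Multiplication by 2 permutes ['F_p], so the sum [S] of inverse squares satisfies [S = S / 4],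
    that is [3 S = 0]. *)
Lemma Fp_harm2_full p : prime p -> (3 < p)%N -> harm2 'F_p p.-1 = 0.
Proof.
move=> pr p3; have two0 : 2 != 0 :> 'F_p.
  by rewrite Fp_natr_eq0 //; apply/negP => /dvdn_leq; lia.
have three0 : 3 != 0 :> 'F_p.
  by rewrite Fp_natr_eq0 //; apply/negP => /dvdn_leq; lia.
have -> : harm2 'F_p p.-1 = \sum_(x : 'F_p) x^-1 ^+ 2.
  rewrite -(Fp_sum_natr (fun x => x^-1 ^+ 2) pr) /harm2 /psum.
  rewrite -(big_mkord xpredT (fun i => (i%:R^-1 ^+ 2 : 'F_p))).
  by rewrite big_ltn ?prime_gt0 // invr0 expr0n add0r big_add1 big_mkord.
set S := \sum_x _; have : S = 2^-1 ^+ 2 * S.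
  rewrite {1}/S (reindex_inj (mulfI two0)) /= /S mulr_sumr.
  by apply: eq_bigr => x _; rewrite invfM exprMn.
move/(congr1 (fun x => 2 ^+ 2 * x)); rewrite mulrA -exprMn divff // expr1n mul1r.
move/eqP; rewrite -subr_eq0 (_ : _ - S = 3 * S); last by ring.
by rewrite mulf_eq0 (negPf three0) => /eqP.
Qed.

Lemma Fp_harm2_half n : prime n.*2.+1 -> (1 < n)%N -> harm2 'F_n.*2.+1 n = 0.
Proof.
move=> pr n1; have p3 : (3 < n.*2.+1)%N by lia.
have nn : (n <= n.*2)%N by rewrite -addnn leq_addr.
have := Fp_harm2_full pr p3; rewrite /= /harm2 (psum_reflect (c := 1) nn).
  rewrite (_ : n.*2 - n = n)%N; last by lia.
  rewrite mul1r -mulr2n -mulr_natl => /eqP.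
  by rewrite mulf_eq0 (negPf (Fp_two_neq0 pr)) => /eqP.
move=> j /andP[_ jn]; rewrite Fp_natr_refl // ?invrN ?sqrrN ?mul1r //; lia.
Qed.

(** As [p] is odd, [j] and [p - j] have opposite parity; this sign cancels the one of
    [1 / (p - j) = -1 / j]. *)
Lemma Fp_alt_inv_refl n j : prime n.*2.+1 -> (0 < j <= n.*2)%N ->
  alt_inv 'F_n.*2.+1 (n.*2.+1 - j) = alt_inv _ j.
Proof.
move=> pr /andP[j0 jn]; rewrite /alt_inv Fp_natr_refl ?(leqW jn) //.
rewrite -signr_odd (_ : odd (_ - _) = ~~ odd j); last by lia.
rewrite -[in RHS]signr_odd.
rewrite invrN mulrN; case: (odd j); rewrite /= ?expr0 ?expr1; ring.
Qed.

Lemma Fp_alt_harm_sub n k : prime n.*2.+1 -> (k <= n.*2)%N ->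
  alt_harm 'F_n.*2.+1 (n.*2 - k)%N = alt_harm _ n.*2 - alt_harm _ k.
Proof.
move=> pr kn; rewrite [alt_harm _ n.*2](psum_reflect (c := 1) kn).
  by rewrite mul1r addrK.
move=> j /andP[j0 jk]; rewrite mul1r Fp_alt_inv_refl // j0.
exact: leq_trans kn.
Qed.

Lemma Fp_alt_harm_half n : prime n.*2.+1 ->
  alt_harm 'F_n.*2.+1 n.*2 = 2 * alt_harm _ n.
Proof.
move=> pr; have nn : (n <= n.*2)%N by rewrite -addnn leq_addr.
have := Fp_alt_harm_sub pr nn.
rewrite (_ : n.*2 - n = n)%N => [e|]; last by lia.
by rewrite mulr_natl mulr2n {1}e subrK.
Qed.

(** In the upper half, index [p - k] carries [A_(p-k) = 2 A_n - A_(k-1)] over [-k], and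
    [A_(k-1) = A_k - (-1)^k / k]. *)
Lemma Fp_alt_harm_double_full n : prime n.*2.+1 ->
  alt_harm_double 'F_n.*2.+1 n.*2
  = 2 * alt_harm_double _ n - 2 * alt_harm _ n * harm _ n - alt_harm2 _ n.
Proof.
move=> pr; rewrite {1}/alt_harm_double psum_double [X in _ + X]psum_rev.
have -> : \sum_(i < n) (alt_harm 'F_n.*2.+1 (n + (n - i)) / (n + (n - i))%:R)
  = psum (fun k => (alt_harm _ k / k%:R - (-1) ^+ k * k%:R^-1 ^+ 2)
             + (- 2 * alt_harm _ n) * inv_nat _ k) n.
  apply: eq_bigr => i _; have ltin := ltn_ord i.
  have -> : (n + (n - i) = n.*2 - i)%N by lia.
  rewrite Fp_alt_harm_sub // ?Fp_alt_harm_half //; last by lia.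
  have -> : (n.*2 - i = n.*2.+1 - i.+1)%N by [].
  rewrite Fp_natr_refl //; last by lia.
  by rewrite /alt_harm psumS /alt_inv /inv_nat invrN; ring.
rewrite psumD psumZ psumD (_ : psum (fun k => - _) n = - alt_harm2 _ n).
  rewrite -/(harm _ _) -/(alt_harm_double _ _); ring.
by rewrite /alt_harm2 /psum sumrN.
Qed.

Lemma Fp_alt_harm_double_sqr n : prime n.*2.+1 -> (1 < n)%N ->
  2 ^+ 2 * alt_harm_double 'F_n.*2.+1 n.*2 = - alt_harm _ n.*2 ^+ 2.
Proof.
move=> pr n1.
have nz : nz_upto 'F_n.*2.+1 n.*2 by exact: (Fp_nz_upto pr).
have h2 : harm2 'F_n.*2.+1 n.*2 = 0 by apply: (Fp_harm2_full pr); lia.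
have := alt_convolution nz; have := alt_harm_double_swap 'F_n.*2.+1 n.*2.
have := alt_harm_sqr 'F_n.*2.+1 n.*2; rewrite h2 Fp_harm_full // mulr0.
rewrite (eq_psum (f := fun j => alt_inv 'F_n.*2.+1 j * alt_harm _ (n.*2 - j))
  (g := fun j => alt_harm _ n.*2 * alt_inv _ j
    + -1 * (alt_inv 'F_n.*2.+1 j * alt_harm _ j)) (n := n.*2)); last first.
  by move=> k /andP[_ kn]; rewrite Fp_alt_harm_sub //; ring.
rewrite psumD !psumZ -/(alt_harm _ _).
move: (psum _ _) (psum _ _) (alt_harm _ _) (alt_harm_double _ _) => x y a w.
move=> e1 e2 e3.
(* [w + x = 0] since [H_(p-1) = 0]; the convolution is [a^2 - y] by reflection and [2 x] by partial
   fractions, with [2 y = a^2]. *)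
transitivity (2 ^+ 2 * (w + x) - 2 * (2 * x)); first by ring.
rewrite e2 -e3; transitivity (2 * y - 2 * a ^+ 2); first by ring.
by rewrite -e1; ring.
Qed.

(** [C(2k, k) = (-4)^k C(-1/2, k)], and [n = -1/2] modulo [p]; the induction compares ratios of
    consecutive terms. *)
Lemma Fp_bin_half n k : prime n.*2.+1 -> (k <= n)%N ->
  'C(2 * k, k)%:R / 2 ^+ k = 'C(n, k)%:R * (-2) ^+ k :> 'F_n.*2.+1.
Proof.
move=> pr; have two0 := Fp_two_neq0 pr.
elim: k => [|k IHk] kn; first by rewrite !bin0 !expr0 divr1 mulr1.
have k0 : k.+1%:R != 0 :> 'F_n.*2.+1 by apply: (Fp_nz_upto pr); rewrite /=; lia.
have e1 : k.+1%:R * 'C(2 * k.+1, k.+1)%:R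
    = 2 * (2 * k%:R + 1) * 'C(2 * k, k)%:R :> 'F_n.*2.+1.
  rewrite -natrM -(natrM _ 2) natr1 -!natrM; congr _%:R.
  have sym : 'C((2 * k).+1, k) = 'C((2 * k).+1, k.+1).
    by rewrite -bin_sub; [congr 'C(_, _); lia | lia].
  have := mul_bin_diag (2 * k).+2 k; have := mul_bin_diag (2 * k).+1 k.
  rewrite /= sym (_ : (2 * k).+2 = 2 * k.+1)%N; last by lia.
  by move=> d1 <-; rewrite -mulnA -d1 mulnA.
have e2 : k.+1%:R * 'C(n, k.+1)%:R = (n%:R - k%:R) * 'C(n, k)%:R :> 'F_n.*2.+1.
  by rewrite -natrB ?(ltnW kn) // -!natrM mul_bin_left.
have e3 : 2 * n%:R = -1 :> 'F_n.*2.+1.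
  apply/eqP; rewrite -addr_eq0 -natrM natr1 Fp_natr_eq0 // mul2n //.
apply: (mulfI k0); rewrite mulrA e1 mulrA e2.
have -> : n%:R = 2^-1 * -1 :> 'F_n.*2.+1 by rewrite -e3 mulKf.
transitivity ((2 * k%:R + 1) * ('C(2 * k, k)%:R / 2 ^+ k) : 'F_n.*2.+1).
  have := expf_neq0 k two0; rewrite exprS.
  move: ('C(_, _)%:R : 'F_n.*2.+1) (2 ^+ k : 'F_n.*2.+1) => x y y0.
  by field; rewrite two0 y0.
rewrite IHk ?(ltnW kn) // [in RHS]exprS.
by field; rewrite two0.
Qed.

(** Centred at [n] because [2 i + 1] vanishes there modulo [2 n + 1]. *)
Lemma sum_center (F : fieldType) (f : nat -> F) n :
  \sum_(i < n.*2.+1) f i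
  = psum (fun k => f (n - k)%N) n + f n + psum (fun k => f (n + k)%N) n.
Proof.
rewrite big_ord_recl -[X in _ + X]/(psum f n.*2) psum_double addrA.
congr (_ + _); rewrite -(big_ord_recl n f) big_ord_recr /= psum_rev.
congr (_ + _); apply: eq_bigr => i _; congr f; have := ltn_ord i; lia.
Qed.

(** Fermat's little theorem; at [x = 0] both sides vanish, by [p - 3 > 0] and [0^-1 = 0]. *)
Lemma Fp_expr_inv p (x : 'F_p) : prime p -> (3 < p)%N ->
  x ^+ (p - 3) = x^-1 ^+ 2.
Proof.
move=> pr p3; have [->|x0] := eqVneq x 0.
  by rewrite invr0 !expr0n; have -> : (p - 3 == 0)%N = false by lia.
have xp : x ^+ p = x.
  rewrite -{1 2}(natr_Zp x) -natrX -(Fp_nat_mod pr) fermat_little //.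
  by rewrite Fp_nat_mod.
apply: (mulIf (expf_neq0 3 x0)); rewrite -exprD subnK ?(ltnW p3) // xp.
by field.
Qed.

(** At [i = n - k] and [i = n + k] the base is [-2k] and [2k], so each pair contributes
    [2 (-1)^(n+k) / (4 k^2)]. *)
Lemma Fp_alt_power_sum n : prime n.*2.+1 -> (1 < n)%N ->
  alt_harm2 'F_n.*2.+1 n
  = 2 * (-1) ^+ n
      * \sum_(i < n.*2.+1) (-1) ^+ i * (2 * i%:R + 1) ^+ (n.*2.+1 - 3).
Proof.
move=> pr n1; have two0 := Fp_two_neq0 pr.
have p3 : (3 < n.*2.+1)%N by lia.
have n2 : 2 * n%:R = -1 :> 'F_n.*2.+1.
  by apply/eqP; rewrite -addr_eq0 -natrM natr1 Fp_natr_eq0 // mul2n.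
rewrite (sum_center (fun i => (-1) ^+ i * (2 * i%:R + 1) ^+ (n.*2.+1 - 3))).
rewrite n2 addNr expr0n (_ : (_ == 0)%N = false) ?mulr0 ?addr0; last by lia.
rewrite -psumD -psumZ; apply: eq_psum => k /andP[k0 kn].
have nzk : k%:R != 0 :> 'F_n.*2.+1.
  by rewrite Fp_natr_eq0 //; apply/negP => /dvdn_leq; lia.
rewrite !(Fp_expr_inv _ pr p3) natrB // natrD.
have -> : 2 * (n%:R - k%:R) + 1 = - (2 * k%:R) :> 'F_n.*2.+1.
  by rewrite mulrBr n2; ring.
have -> : 2 * (n%:R + k%:R) + 1 = 2 * k%:R :> 'F_n.*2.+1.
  by rewrite mulrDr n2; ring.
rewrite invrN sqrrN -(signr_odd _ (n - k)) oddB // exprD.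
rewrite -(signr_odd _ n) -(signr_odd _ k).
move: (k%:R : 'F_n.*2.+1) nzk => x x0.
by case: (odd n); case: (odd k); rewrite /= ?expr0 ?expr1; field;
   rewrite two0 x0.
Qed.

Lemma Fp_sum_bin_harm_sqr n : prime n.*2.+1 ->
  psum (fun k => 'C(2 * k, k)%:R / 2 ^+ k * harm 'F_n.*2.+1 k ^+ 2) n
  = (-1) ^+ n * ((2 ^ n.*2 - 1) %/ n.*2.+1)%:R ^+ 2
    - \sum_(i < n.*2.+1) (-1) ^+ i * (2 * i%:R + 1) ^+ (n.*2.+1 - 3).
Proof.
move=> pr; have two0 := Fp_two_neq0 pr.
have po : odd n.*2.+1 by rewrite /= odd_double.
(* Below [n = 2] only [p = 3] is prime, where [harm2] does not vanish; it is settled by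
   computation. *)
have [n1|n1] := leqP n 1.
  case: n n1 pr {po two0} => [|[|n]] // _ pr.
  rewrite !big_ord_recr !big_ord0 /= /harm !psumS !psum0.
  by apply/eqP; vm_compute.
have nz2 : nz_upto 'F_n.*2.+1 n.*2 by exact: (Fp_nz_upto pr).
have nz : nz_upto 'F_n.*2.+1 n by move=> k kn; apply: nz2; lia.
transitivity (btrans n (fun k => harm 'F_n.*2.+1 k ^+ 2)).
  rewrite /btrans big_ord_recl /harm psum0 expr0n mulr0 add0r.
  by apply: eq_bigr => k _; rewrite /= /bump add1n Fp_bin_half.
apply: (mulfI two0); rewrite btrans_harm_sqr // mulrCA double_sum_expand.
rewrite Fp_harm2_half //.
have := fermat_quotient_alt_harm pr po; rewrite /= => q1.
have := Fp_alt_harm_half pr; have := alt_harm_even nz2.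
rewrite Fp_harm_full // subr0 => e1 e2.
have := Fp_alt_harm_double_full pr; have := Fp_alt_harm_double_sqr pr n1.
have := Fp_alt_power_sum pr n1.
move: q1 e1 e2; set q := (_ %/ _)%:R; set s := \sum_(i < _) _.
move: (sign_mul_self 'F_n.*2.+1 n); set t := (-1) ^+ n.
move: (alt_harm2 _ _) (alt_harm_double _ n) (alt_harm_double _ n.*2) (harm _ _).
move: (alt_harm _ n) (alt_harm _ n.*2) => a af a2 w wf h tt q1 e1 e2 e3 e4 e5.
have af2 : af = - (2 * q) by rewrite q1 opprK.
have aq : a = - q by apply: (mulfI two0); rewrite -e2 af2 mulrN.
have wfq : wf = - q ^+ 2.
  apply: (mulfI (expf_neq0 2 two0)); rewrite e4 af2; ring.
have w2 : 2 * w = wf + 2 * a * h + a2 by rewrite e5; ring.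
(* With [h = -2q] and [a = -q], the coefficient of [q^2] is [8 - 1 + 4 - 9 = 2] and that of [a2] is
   [2 - 3 = -1]; [t * t = 1] then clears the sign before [s]. *)
rewrite (_ : 6 * w = 3 * (2 * w)); last by ring.
rewrite w2 wfq aq -e1 af2 e3; ring: tt.
Qed.

(** * Reduction of p-integral rationals *)

(* The graph of the reduction map from Z_(p) to F_p; the fraction need not be
   in lowest terms. *)
Definition reduces (p : nat) (x : rat) (u : 'F_p) : Prop :=
  exists a b : int,
    [/\ b%:~R != 0 :> 'F_p, x = a%:~R / b%:~R & u = a%:~R / b%:~R].

Arguments reduces : clear implicits.

Lemma intr_Fp_eq0 p (b : int) : prime p -> (b%:~R == 0 :> 'F_p) = (p %| `|b|)%N.
Proof.
move=> pr; rewrite -Fp_natr_eq0 //; case: (intP b) => // n.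
  by rewrite mulrNz oppr_eq0.
Qed.

Lemma intr_rat_neq0 p (b : int) : b%:~R != 0 :> 'F_p -> b%:~R != 0 :> rat.
Proof. by rewrite intr_eq0; apply: contraNneq => ->. Qed.

Lemma reduces_int p (a : int) : reduces p a%:~R a%:~R.
Proof. by exists a, 1; rewrite !divr1 oner_neq0. Qed.

Lemma reduces_nat p (m : nat) : reduces p m%:R m%:R.
Proof. exact: (reduces_int p m). Qed.

Lemma reducesD p x y u v :
  reduces p x u -> reduces p y v -> reduces p (x + y) (u + v).
Proof.
move=> [a [b [b0 -> ->]]] [c [d [d0 -> ->]]]; exists (a * d + c * b), (b * d).
rewrite !rmorphM !rmorphD !rmorphM /= mulf_neq0 //.
by rewrite !addf_div ?(intr_rat_neq0 b0) ?(intr_rat_neq0 d0).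
Qed.

Lemma reducesM p x y u v :
  reduces p x u -> reduces p y v -> reduces p (x * y) (u * v).
Proof.
move=> [a [b [b0 -> ->]]] [c [d [d0 -> ->]]]; exists (a * c), (b * d).
by rewrite !rmorphM /= mulf_neq0 // !mulf_div.
Qed.

Lemma reducesN p x u : reduces p x u -> reduces p (- x) (- u).
Proof.
rewrite -mulN1r -[- u]mulN1r; apply: reducesM; exact: (reduces_int p (-1)).
Qed.

Lemma reducesX p x u k : reduces p x u -> reduces p (x ^+ k) (u ^+ k).
Proof.
move=> xu; elim: k => [|k IHk]; first exact: (reduces_nat p 1).
by rewrite !exprS; apply: reducesM.
Qed.

Lemma reducesV p x u : u != 0 -> reduces p x u -> reduces p x^-1 u^-1.
Proof.
move=> u0 [a [b [b0 -> e]]]; exists b, a; rewrite e !invf_div.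
by split=> //; apply: contraNneq u0; rewrite e => ->; rewrite mul0r.
Qed.

Lemma reduces_sum p (I : finType) (f : I -> rat) (g : I -> 'F_p) :
  (forall i, reduces p (f i) (g i)) -> reduces p (\sum_i f i) (\sum_i g i).
Proof.
move=> fg; apply: (big_ind2 (reduces p)) => // [|x u y v].
- exact: (reduces_nat p 0).
- exact: reducesD.
Qed.

(** By cross-multiplication and Gauss's lemma the reduced denominator divides [b], which is prime to
    [p]. *)
Lemma reduces_integral p x u : prime p -> reduces p x u -> p_integral p x.
Proof.
move=> pr [a [b [b0 e _]]]; have bq := intr_rat_neq0 b0.
rewrite /p_integral prime_coprime //.
apply: contra b0 => pd; rewrite intr_Fp_eq0 //; apply: dvdn_trans pd _.
have : numq x * b = a * denq x.
  by apply: (@intr_inj rat); rewrite !rmorphM /= numqE e mulrAC divfK.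
move/(congr1 absz); rewrite !abszM => ab.
have cp : coprime `|denq x| `|numq x| by rewrite coprime_sym coprime_num_den.
by rewrite -(Gauss_dvdr _ cp) ab dvdn_mull.
Qed.

Lemma reduces_congr p x y u :
  prime p -> reduces p x u -> reduces p y u -> rat_congr p x y.
Proof.
move=> pr xu yu; split; [exact: reduces_integral xu|exact: reduces_integral yu|].
(* The difference reduces to 0, so [p] divides its numerator [a]; the quotient [c] supplies the
   witness [c / b]. *)
have [a [b [b0 e /esym/eqP]]] := reducesD xu (reducesN yu).
rewrite subrr mulf_eq0 invr_eq0 (negPf b0) orbF intr_Fp_eq0 // => pa.
have /dvdzP[c ac] : (p %| a)%Z by [].
have pb : reduces p (c%:~R / b%:~R) (c%:~R / b%:~R) by exists c, b.
exists (c%:~R / b%:~R); first exact: reduces_integral pb.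
by rewrite e ac rmorphM /= mulrA [p%:R * _]mulrC.
Qed.

(** * Euler numbers modulo p *)

(** Compare coefficients of [t^m / m!] in the defining product; the constant 1 affects only [i = m],
    where it doubles [E_m]. *)
Lemma euler_number_rec m :
  2 * euler_number m
  = 2 - \sum_(i < m) 'C(m, i)%:R * 2 ^+ (m - i) * euler_number i.
Proof.
have fact_neq0 k : k`!%:R != 0 :> rat by rewrite pnatr_eq0 -lt0n fact_gt0.
have gen := euler_number_gen m.
have {gen} : m`!%:R * 2 / m`!%:R
    = \sum_(i < m.+1) m`!%:R * (euler_number i / i`!%:R
        * fps_add (fps_exp 2) (fps_const 1) (m - i)%N).
  transitivity (m`!%:R * fps_scale 2 (fps_exp 1) m).
    by rewrite /fps_scale /fps_exp expr1n mul1r mulrA.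
  by rewrite -gen /fps_mul mulr_sumr.
rewrite mulrC mulKf // => e.
rewrite [X in X - _]e {e}.
rewrite big_ord_recr /= subnn /fps_add /fps_exp /fps_const expr0 fact0 divr1.
rewrite (eq_bigr (fun i : 'I_m => 'C(m, i)%:R * 2 ^+ (m - i) * euler_number i)).
  have := fact_neq0 m; move: (m`!%:R : rat) (\sum_(i < m) _) => f S f0.
  by field.
move=> i _; have im := ltnW (ltn_ord i).
have -> : m`!%:R = 'C(m, i)%:R * (i`!%:R * (m - i)`!%:R) :> rat.
  by rewrite -!natrM bin_fact.
case E : (m - i)%N => [|k]; first by have := ltn_ord i; lia.
rewrite addr0; move: (fact_neq0 i) (fact_neq0 k.+1) => f1 f2.
by field; rewrite f1 f2.
Qed.

(** With [x = 2i + 1], the alternating sum of [(x + 2)^m + x^m] telescopes. Modulo [p] its end terms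
    are [1] and [-(-1)^p = 1], giving the 2; the binomial expansion of [(x + 2)^m] gives the
    rest. *)
Lemma alt_power_sum_rec p m : prime p -> odd p ->
  let s k := \sum_(i < p) (-1) ^+ i * (2 * i%:R + 1) ^+ k : 'F_p in
  2 * s m = 2 - \sum_(i < m) 'C(m, i)%:R * 2 ^+ (m - i) * s i.
Proof.
move=> pr po s.
have tele k : \sum_(i < k) ((-1) ^+ i * (2 * i%:R + 1 + 2) ^+ m
    + (-1) ^+ i * (2 * i%:R + 1) ^+ m)
    = 1 - (-1) ^+ k * (2 * k%:R + 1) ^+ m :> 'F_p.
  elim: k => [|k IHk].
    by rewrite big_ord0 mulr0 add0r expr1n expr0 mulr1 subrr.
  rewrite big_ord_recr /= IHk exprS -(natr1 k).
  rewrite (_ : 2 * (k%:R + 1) + 1 = 2 * k%:R + 1 + 2); ring.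
have p0 : p%:R = 0 :> 'F_p by apply/eqP; rewrite Fp_natr_eq0.
have := tele p; rewrite p0 mulr0 add0r expr1n -signr_odd po expr1 mulr1 opprK.
rewrite big_split -/(s m) /= => e.
have {}e : \sum_(i < m.+1) 'C(m, i)%:R * 2 ^+ (m - i) * s i + s m = 2.
  rewrite -[RHS]e; congr (_ + _).
  rewrite (eq_bigr (fun j : 'I_m.+1 => \sum_(i < p)
    'C(m, j)%:R * 2 ^+ (m - j) * ((-1) ^+ i * (2 * i%:R + 1) ^+ j))).
  2: by move=> j _; rewrite mulr_sumr.
  rewrite exchange_big; apply: eq_bigr => i _ /=.
  rewrite [2 * i%:R + 1 + 2]addrC exprDn mulr_sumr; apply: eq_bigr => j _.
  by rewrite -[in RHS](mulr_natl (_ * _)); ring.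
by rewrite -[X in X - _]e big_ord_recr /= binn subnn; ring.
Qed.

Lemma reduces_euler_number p m : prime p -> odd p ->
  reduces p (euler_number m)
    (\sum_(i < p) (-1) ^+ i * (2 * i%:R + 1) ^+ m).
Proof.
move=> pr po; have two0 : 2 != 0 :> 'F_p.
  rewrite Fp_natr_eq0 //; apply/negP => /dvdn_leq.
  by case: p pr po => [|[|[|p]]] //; lia.
elim/ltn_ind: m => m IHm.
rewrite -[euler_number m](mulKf (_ : 2 != 0)) // -[\sum_i _](mulKf two0).
rewrite euler_number_rec (alt_power_sum_rec _ pr po).
apply: reducesM; first by apply: reducesV => //; exact: (reduces_nat p 2).
apply: reducesD; first exact: (reduces_nat p 2).
apply/reducesN/reduces_sum => i; apply: reducesM; last exact: IHm.
by apply: reducesM; [exact: reduces_nat|apply: reducesX; exact: (reduces_nat p 2)].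
Qed.

Lemma reduces_harmonic p k : nz_upto 'F_p k -> reduces p (harmonic k) (harm 'F_p k).
Proof.
move=> nz; rewrite /harmonic big_add1 big_mkord.
apply: reduces_sum => i; apply: reducesV; first exact: nz.
exact: reduces_nat.
Qed.

Theorem theorem1p2 (p : nat) (p_prime : prime p) (p_odd : odd p) :
  rat_congr p
    (\sum_(1 <= k < ((p - 1) %/ 2).+1)
        'C(2 * k, k)%:R / 2 ^+ k * harmonic k ^+ 2)
    ((-1) ^+ ((p - 1) %/ 2) * fermat_quotient p 2 ^+ 2
       - euler_number (p - 3)).
Proof.
have [n pn] : {n | p = n.*2.+1} by exists p./2; lia.
subst p; rewrite (_ : (_ - 1) %/ 2 = n)%N; last by lia.
have two0 := Fp_two_neq0 p_prime.
have two := reduces_nat n.*2.+1 2.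
apply: (reduces_congr p_prime (u := psum (fun k =>
   'C(2 * k, k)%:R / 2 ^+ k * harm 'F_n.*2.+1 k ^+ 2) n)).
  rewrite big_add1 big_mkord; apply: reduces_sum => i.
  apply: reducesM; last first.
    apply/reducesX/reduces_harmonic => j ji.
    apply: (Fp_nz_upto p_prime); apply: leq_trans ji _.
    apply: leq_trans (ltn_ord i) _.
    by rewrite /= -addnn leq_addr.
  apply: reducesM; first exact: reduces_nat.
  by apply: reducesV; [exact: expf_neq0|exact: reducesX].
rewrite Fp_sum_bin_harm_sqr //; apply: reducesD; last first.
  exact/reducesN/reduces_euler_number.
apply: reducesM; first by apply: reducesX; exact: (reduces_int _ (-1)).
apply: reducesX; rewrite /fermat_quotient subn1 /=.
(* The denominator [p] is zero in ['F_p], so the quotient must be recognised as an integer before it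
   is reduced. *)
have -> : (2 ^+ n.*2 - 1) / n.*2.+1%:R
    = ((2 ^ n.*2 - 1) %/ n.*2.+1)%:R :> rat.
  have -> : 2 ^+ n.*2 - 1 = (2 ^ n.*2 - 1)%:R :> rat.
    by rewrite natrB ?expn_gt0 // natrX.
  rewrite -{1}(divnK (dvdn_fermat2 p_prime p_odd)) natrM mulfK //.
  by rewrite pnatr_eq0.
exact: reduces_nat.
Qed.
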